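(* Let $0<p<1$, $q=1-p$ and $m\ge1$, and let $D_m$ be the unscaled level-$m$ Laplacian on $V_m=\{k/4^m:0\le k\le 4^m\}$ defined in the context. (i) Let $u_m$ be a Dirichlet eigenfunction of $D_m$ on $V_m$ with eigenvalue $\lambda_m$. Let $\lambda=\lambda_{m+1}$ be one of the four values $$2-\sqrt{2+2\sqrt{1-p\lambda_m+p^2\lambda_m}},\quad 2-\sqrt{2-2\sqrt{1-p\lambda_m+p^2\lambda_m}},\quad 2+\sqrt{2-2\sqrt{1-p\lambda_m+p^2\lambda_m}},\quad 2+\sqrt{2+2\sqrt{1-p\lambda_m+p^2\lambda_m}},$$ and assume $\lambda_{m+1}\ne 2,\,2(1\pm\sqrt q)$. Extend $u_m$ to $V_{m+1}$ as follows: on each $m$-cell $[\frac{k}{4^m},\frac{k+1}{4^m}]$, with endpoint values $x_1=u_m(\frac{k}{4^m})$, $x_2=u_m(\frac{k+1}{4^m})$, the values $y_1,z,y_2$ at the three new points $\frac{4k+1}{4^{m+1}},\frac{4k+2}{4^{m+1}},\frac{4k+3}{4^{m+1}}$ are $$y_1=\frac{-4pqx_2-2px_1(2+2p-4\lambda+\lambda^2)}{(-4q+(\lambda-2)^2)(\lambda-2)},\qquad z=\frac{2p(x_1+x_2)}{(\lambda-2)^2-4q},\qquad y_2=\frac{-4pqx_1-2px_2(2+2p-4\lambda+\lambda^2)}{(-4q+(\lambda-2)^2)(\lambda-2)}.$$ Then the extended function is a Dirichlet eigenfunction of $D_{m+1}$ on $V_{m+1}$ with eigenvalue $\lambda_{m+1}$.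 (ii) This process, together with the eigenvalues $2,\,2(1-\sqrt q),\,2(1+\sqrt q)$ born on level $m+1$, produces the complete spectrum on level $m+1$: the set of Dirichlet eigenvalues of $D_{m+1}$ is exactly the set of all values $\lambda_{m+1}$ obtained as in (i) from the Dirichlet eigenvalues $\lambda_m$ of $D_m$, together with $2,\,2(1-\sqrt q),\,2(1+\sqrt q)$.
   Context: Let $I=[0,1]$, $F_i(x)=\frac x4+\frac i4$ for $i=0,1,2,3$. An $m$-cell is $A=F_{i_1}\circ\cdots\circ F_{i_m}(I)=[\frac{k}{4^m},\frac{k+1}{4^m}]$; let $i(A)=\#\{j: i_j\in\{0,3\}\}$. With $0<p<1$ and $q=1-p$, set $\mu(A)=\frac{p^{i(A)}q^{m-i(A)}}{2^m}$ (measure) and $R(A)=\frac{q^{i(A)}p^{m-i(A)}}{2^m}$ (resistance), so $\mu(A)R(A)=(pq/4)^m$. For $x=\frac k{4^m}$, $1\le k\le4^m-1$, with $m$-cells $A_0=[\frac{k-1}{4^m},\frac k{4^m}]$ and $A_1=[\frac k{4^m},\frac{k+1}{4^m}]$, $$-\Delta_m^{(p)}f(x)=\frac{2}{\mu(A_0)+\mu(A_1)}\left[\frac{f(x)-f(\frac{k+1}{4^m})}{R(A_1)}+\frac{f(x)-f(\frac{k-1}{4^m})}{R(A_0)}\right].$$ Eigenvalues are written here without the renormalization factor: $D_m=\left(\frac{pq}{4}\right)^m(-\Delta_m^{(p)})$. A Dirichlet eigenfunction of $D_m$ with eigenvalue $\lambda$ is a nonzero function $f$ on $V_m=\{k/4^m:0\le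 k\le4^m\}$ with $f(0)=f(1)=0$ and $D_mf=\lambda f$ on $V_m\setminus\{0,1\}$. An eigenvalue is ''born'' on level $m+1$ if it is an eigenvalue there not produced from level $m$ by extension. *)

(* Defs.v *)
From mathcomp Require Import all_boot all_order all_algebra.
From mathcomp Require Import reals ring.

Set Implicit Arguments.
Unset Strict Implicit.
Unset Printing Implicit Defensive.

Import Order.TTheory GRing.Theory Num.Theory.
Local Open Scope ring_scope.

Section Laplacian.
Variable R : realType.
Implicit Types (p x l lm : R) (w : seq nat) (m k : nat) (f u v : R -> R).

Definition Fmap (i : nat) x : R := x / 4 + i%:R / 4.

Definition Fword w x : R := foldr Fmap x w.

(* The word (i_1, ..., i_m) of the m-cell [k/4^m, (k+1)/4^m] is the base-4
   expansion of k on m digits, most significant digit first; see Fword_cell. *)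
Fixpoint cell_word m k : seq nat :=
  if m is m'.+1 then ((k %/ 4 ^ m') %% 4)%N :: cell_word m' k else [::].

Lemma Fword_cell m k x : (k < 4 ^ m)%N ->
  Fword (cell_word m k) x = (k%:R + x) / 4 ^+ m.
Proof.
have E n j : Fword (cell_word n j) x = ((j %% 4 ^ n)%N%:R + x) / 4 ^+ n.
  elim: n => [|n IHn]; first by rewrite modn1 expr0 divr1 add0r.
  have -> : (j %% 4 ^ n.+1 = (j %/ 4 ^ n) %% 4 * 4 ^ n + j %% 4 ^ n)%N.
    rewrite expnS modn_divl {1}(divn_eq (j %% (4 * 4 ^ n)) (4 ^ n)).
    by rewrite modn_dvdm ?dvdn_mull.
  rewrite /= /Fmap -/(Fword _ _) IHn natrD natrM natrX exprS.
  have hn : (4 : R) ^+ n != 0 by rewrite expf_neq0 ?pnatr_eq0.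
  by field.
by move=> lt_k; rewrite E modn_small.
Qed.

Definition outer w : nat := count (pred2 0%N 3%N) w.

Definition mu p w : R :=
  p ^+ outer w * (1 - p) ^+ (size w - outer w) / 2 ^+ size w.

Definition res p w : R :=
  (1 - p) ^+ outer w * p ^+ (size w - outer w) / 2 ^+ size w.

Definition pt m k : R := k%:R / 4 ^+ m.

(* Functions on V_m = {pt m k | k <= 4 ^ m} are represented by functions on R,
   of which only the values on V_m are ever used. *)

(* -Delta_m^(p) f at pt m k, meaningful for 0 < k < 4 ^ m. *)
Definition neg_laplacian p m f k : R :=
  let A0 := cell_word m k.-1 in
  let A1 := cell_word m k in
  2 / (mu p A0 + mu p A1) *
    ((f (pt m k) - f (pt m k.+1)) / res p A1
     + (f (pt m k) - f (pt m k.-1)) / res p A0).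

Definition D p m f k : R := (p * (1 - p) / 4) ^+ m * neg_laplacian p m f k.

Definition dirichlet_eigenfunction p m l f : Prop :=
  [/\ exists2 k, (k <= 4 ^ m)%N & f (pt m k) != 0,
      f 0 = 0, f 1 = 0 &
      forall k, (0 < k < 4 ^ m)%N -> D p m f k = l * f (pt m k)].

Definition dirichlet_eigenvalue p m l : Prop :=
  exists f, dirichlet_eigenfunction p m l f.

Definition branches p lm : seq R :=
  let s := Num.sqrt (1 - p * lm + p ^+ 2 * lm) in
  [:: 2 - Num.sqrt (2 + 2 * s); 2 - Num.sqrt (2 - 2 * s);
      2 + Num.sqrt (2 - 2 * s); 2 + Num.sqrt (2 + 2 * s)].

Definition exceptional p : seq R :=
  let q := 1 - p in
  [:: 2; 2 * (1 - Num.sqrt q); 2 * (1 + Num.sqrt q)].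

Definition extends m u v : Prop :=
  forall k, (k <= 4 ^ m)%N -> v (pt m k) = u (pt m k).

(* v on V_(m+1) is the spectral decimation extension of u on V_m, with
   parameter l. *)
Definition decimation_extension p m l u v : Prop :=
  let q := 1 - p in
  extends m u v /\
  forall k, (k < 4 ^ m)%N ->
    let x1 := u (pt m k) in
    let x2 := u (pt m k.+1) in
    [/\ v (pt m.+1 (4 * k + 1)) =
          (- 4 * p * q * x2 - 2 * p * x1 * (2 + 2 * p - 4 * l + l ^+ 2))
            / ((- 4 * q + (l - 2) ^+ 2) * (l - 2)),
        v (pt m.+1 (4 * k + 2)) =
          2 * p * (x1 + x2) / ((l - 2) ^+ 2 - 4 * q) &
        v (pt m.+1 (4 * k + 3)) =
          (- 4 * p * q * x1 - 2 * p * x2 * (2 + 2 * p - 4 * l + l ^+ 2))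
            / ((- 4 * q + (l - 2) ^+ 2) * (l - 2))].

(* An eigenvalue on level m+1 none of whose eigenfunctions is an extension of
   a Dirichlet eigenfunction of level m. *)
Definition born p m l : Prop :=
  dirichlet_eigenvalue p m.+1 l /\
  ~ (exists lm u v, [/\ dirichlet_eigenfunction p m lm u,
                        dirichlet_eigenfunction p m.+1 l v & extends m u v]).

End Laplacian.

(* Main.v *)
(* Since mu(A) R(A) does not depend on the m-cell A, D_m is 2 (1 - P) for the
   random walk P on V_m whose steps are weighted by the measures of the adjacent
   cells.  On level m+1 the eigenvalue equation splits into three equations
   inside each m-cell and one junction equation at each interior point of V_m.
   With s = 2 - l and q = 1 - p, the former determine the inner values from the
   endpoint values exactly when s (s^2 - 4 q) != 0, i.e. when l is not
   exceptional; the junction equations then become the level-m equations for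
   the lm such that (s^2 - 2)^2 = 4 (1 - p q lm).  The bound 0 <= lm <= 4
   keeps the square roots in the branches genuine.  When l is exceptional, the
   cell equations force x1 = x2 or x1 = - x2, so an eigenfunction vanishes on
   V_m; one is obtained by rescaling a fixed profile on each m-cell. *)
Require Import Defs.
From mathcomp Require Import all_boot all_order all_algebra.
From mathcomp Require Import reals.
From mathcomp Require Import ring lra zify.

Set Implicit Arguments.
Unset Strict Implicit.
Unset Printing Implicit Defensive.

Import Order.TTheory GRing.Theory Num.Theory.
Local Open Scope ring_scope.

(** * Words, measures and resistances of cells *)

Lemma cell_word_child m k i : (i < 4)%N ->
  cell_word m.+1 (4 * k + i) = rcons (cell_word m k) i.
Proof.
move=> i4; elim: m => [|m IH].
  by rewrite /= expn0 divn1 mulnC modnMDl modn_small.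
rewrite [LHS]/= -/(cell_word m.+1 (4 * k + i)) IH /=; congr (_ %% _ :: _)%N.
by rewrite expnS divnMA mulnC divnMDl // (divn_small i4) addn0.
Qed.

Lemma size_cell_word m k : size (cell_word m k) = m.
Proof. by elim: m => //= m ->. Qed.

Section Path.
Variable R : realType.
Implicit Types (p l lm a b : R) (m k : nat) (f u v : R -> R) (g h : nat -> R).

Definition weight p m k : R := mu p (cell_word m k).

Lemma weight_gt0 p m k : 0 < p -> p < 1 -> 0 < weight p m k.
Proof.
move=> p0 p1; have q0 : 0 < 1 - p by lra.
by rewrite /weight /mu divr_gt0 ?mulr_gt0 ?exprn_gt0.
Qed.

(** Conductances are proportional to measures with a constant depending only on the level; it
    cancels the renormalization factor in [D], leaving only measures. *)
Lemma res_weight p m k : 0 < p -> p < 1 ->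
  (res p (cell_word m k))^-1 = weight p m k / (p * (1 - p) / 4) ^+ m.
Proof.
move=> p0 p1; have q0 : 0 < 1 - p by lra.
rewrite /weight /mu /res size_cell_word.
have := count_size (pred2 0%N 3%N) (cell_word m k).
rewrite -/(outer _) size_cell_word.
move: (outer _) => n nm; have := subnKC nm; move: (m - n)%N => d <-.
rewrite !exprD !exprMn !exprVn.
have -> : (4 : R) = 2 * 2 by ring.
rewrite !exprMn.
have nz (x : R) j : 0 < x -> x ^+ j != 0 by move=> x0; rewrite expf_neq0 ?gt_eqF.
by field; rewrite !nz // ltr0n.
Qed.

Lemma weight_child p m k i : (i < 4)%N ->
  weight p m.+1 (4 * k + i) =
  weight p m k * (if (i == 0%N) || (i == 3%N) then p else 1 - p) / 2.
Proof.
move=> i4; rewrite /weight cell_word_child // /mu /outer -cats1 count_cat size_cat.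
rewrite /= addn0.
set w := cell_word m k; have := count_size (pred2 0%N 3%N) w.
move: (count _ w) (size w) => n N nN.
have nz : (2 : R) ^+ N != 0 by rewrite expf_neq0 ?pnatr_eq0.
case: ifP => _ /=.
  by rewrite subnDr !addn1 !exprS; field.
by rewrite addn0 -addnBAC // !addn1 !exprS; field.
Qed.

(** * The eigenvalue equation as a recurrence on sequences *)

Definition balance p m l g : Prop := forall k, (k.+1 < 4 ^ m)%N ->
  (2 - l) * (weight p m k + weight p m k.+1) * g k.+1 =
  2 * (weight p m k * g k + weight p m k.+1 * g k.+2).

Definition eigenseq p m l g : Prop :=
  [/\ exists2 k, (k <= 4 ^ m)%N & g k != 0, g 0 = 0, g (4 ^ m)%N = 0 &
      balance p m l g].

Lemma D_eigenE p m l f k : 0 < p -> p < 1 ->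
  D p m f k.+1 = l * f (pt R m k.+1) <->
  (2 - l) * (weight p m k + weight p m k.+1) * f (pt R m k.+1) =
  2 * (weight p m k * f (pt R m k) + weight p m k.+1 * f (pt R m k.+2)).
Proof.
move=> p0 p1; rewrite /D /neg_laplacian /= !res_weight //.
rewrite -/(weight p m k) -/(weight p m k.+1).
have w0 := weight_gt0 m k p0 p1; have w1 := weight_gt0 m k.+1 p0 p1.
move: (weight p m k) (weight p m k.+1) w0 w1 => a b a0 b0.
move: (f _) (f _) (f _) => x z y.
have c0 : (p * (1 - p) / 4) ^+ m != 0.
  by rewrite expf_neq0 // gt_eqF // divr_gt0 // mulr_gt0 // subr_gt0.
move: (_ ^+ m) c0 => c c0.
have ab0 : a + b != 0 by rewrite gt_eqF // addr_gt0.
have -> : c * (2 / (a + b) * ((y - z) * (b / c) + (y - x) * (a / c))) =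
  2 * ((y - z) * b + (y - x) * a) / (a + b) by field; rewrite ab0.
split=> [h|h].
  have : 2 * ((y - z) * b + (y - x) * a) = l * y * (a + b).
    by rewrite -h; field.
  lra.
apply: (mulIf ab0); rewrite divfK //; lra.
Qed.

Lemma pt0 m : pt R m 0 = 0.
Proof. by rewrite /pt mul0r. Qed.

Lemma pt_last m : pt R m (4 ^ m) = 1.
Proof. by rewrite /pt natrX divff // expf_neq0 ?pnatr_eq0. Qed.

Lemma pt_child m k : pt R m.+1 (4 * k) = pt R m k.
Proof.
rewrite /pt exprS natrM; have : (4 : R) ^+ m != 0 by rewrite expf_neq0 ?pnatr_eq0.
by move=> ?; field.
Qed.

Lemma dirichlet_eigenfunctionE p m l f : 0 < p -> p < 1 ->
  dirichlet_eigenfunction p m l f <-> eigenseq p m l (fun k => f (pt R m k)).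
Proof.
move=> p0 p1; rewrite /dirichlet_eigenfunction /eigenseq pt0 pt_last.
split=> -[nz f0 f1 h]; split=> //.
  by move=> k kN; apply/(D_eigenE m l f k p0 p1)/h.
by move=> [//|k] kN; apply/(D_eigenE m l f k p0 p1)/h.
Qed.

(** Truncating [x * 4 ^+ m] recovers the index of a grid point, so sequences can stand for functions
    on V_m. *)
Lemma interpolation m g : {f : R -> R | forall k, f (pt R m k) = g k}.
Proof.
exists (fun x => g (Num.truncn (x * 4 ^+ m))) => k.
by rewrite /pt divfK ?natrK // expf_neq0 ?pnatr_eq0.
Qed.

Lemma eigenseq_ext p m l g h : (forall k, (k <= 4 ^ m)%N -> g k = h k) ->
  eigenseq p m l g -> eigenseq p m l h.
Proof.
move=> gh [[k kN gk] g0 g1 b]; split.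
- by exists k; rewrite -?gh.
- by rewrite -(gh 0%N).
- by rewrite -(gh (4 ^ m)%N).
move=> j jN; rewrite -(gh _ (ltnW (ltnW jN))) -(gh _ (ltnW jN)) -(gh _ jN).
exact: b.
Qed.

Lemma dirichlet_eigenvalueE p m l : 0 < p -> p < 1 ->
  dirichlet_eigenvalue p m l <-> exists g, eigenseq p m l g.
Proof.
move=> p0 p1; split=> -[f /= hf].
  by exists (fun k => f (pt R m k)); apply/dirichlet_eigenfunctionE.
have [v vf] := interpolation m f.
by exists v; apply/dirichlet_eigenfunctionE => //; apply: eigenseq_ext hf.
Qed.

(* Maximum principle: evaluate the equation where |g| is largest. *)
Lemma eigenvalue_bounds p m l g : 0 < p -> p < 1 ->
  eigenseq p m l g -> 0 <= l <= 4.
Proof.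
move=> p0 p1 [[k0 k0N gk0] g0 g1 b].
have [i _ imax] := @arg_maxP _ _ _ (Ordinal (k0N : (k0 < (4 ^ m).+1)%N))
  xpredT (fun j : 'I_(4 ^ m).+1 => `|g j|) isT.
have le k : (k <= 4 ^ m)%N -> `|g k| <= `|g i|.
  by move=> kN; exact: (imax (Ordinal (kN : (k < (4 ^ m).+1)%N)) isT).
have gi0 : 0 < `|g i| by apply: lt_le_trans (le _ k0N); rewrite normr_gt0.
case: i gi0 le {imax} => -[|k] /= kN gk0' le.
  by move: gk0'; rewrite g0 normr0 ltxx.
have kN' : (k.+1 < 4 ^ m)%N.
  rewrite ltn_neqAle -ltnS kN andbT; apply/eqP => e.
  by move: gk0'; rewrite e g1 normr0 ltxx.
have w0 := weight_gt0 m k p0 p1; have w1 := weight_gt0 m k.+1 p0 p1.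
have := congr1 (fun x => `|x|) (b k kN').
have lek := le k (ltnW (ltnW kN')); have lek2 := le k.+2 kN'.
move: (weight p m k) (weight p m k.+1) w0 w1 => x y x0 y0 e.
have : `|2 - l| * ((x + y) * `|g k.+1|) <= 2 * ((x + y) * `|g k.+1|).
  have -> : `|2 - l| * ((x + y) * `|g k.+1|) = `|2 * (x * g k + y * g k.+2)|.
    by rewrite -e !normrM mulrA (gtr0_norm (addr_gt0 x0 y0)).
  rewrite normrM normr_nat ler_pM2l //; apply: le_trans (ler_normD _ _) _.
  by rewrite !normrM !(gtr0_norm x0, gtr0_norm y0) mulrDl lerD // ler_pM2l.
rewrite ler_pM2r ?mulr_gt0 ?addr_gt0 // ler_norml; lra.
Qed.

(** * Splitting the level m+1 equations into cell and junction equations *)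

Definition cell_balance p l g k : Prop :=
  [/\ (2 - l) * g (4 * k + 1)%N = 2 * (p * g (4 * k)%N + (1 - p) * g (4 * k + 2)%N),
      (2 - l) * g (4 * k + 2)%N = g (4 * k + 1)%N + g (4 * k + 3)%N &
      (2 - l) * g (4 * k + 3)%N = 2 * (p * g (4 * k.+1)%N + (1 - p) * g (4 * k + 2)%N)].

Definition junction_balance p m l g k : Prop :=
  (2 - l) * (weight p m k + weight p m k.+1) * g (4 * k.+1)%N =
  2 * (weight p m k * g (4 * k + 3)%N + weight p m k.+1 * g (4 * k.+1 + 1)%N).

(** The children of a cell have p/2, q/2, q/2, p/2 times its weight. Inside a cell its weight
    cancels, and at the midpoint q does too; at a junction both adjacent children are outer, so p/2
    cancels. *)
Lemma balance_child p m l g : 0 < p -> p < 1 ->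
  balance p m.+1 l g <->
  (forall k, (k < 4 ^ m)%N -> cell_balance p l g k) /\
  (forall k, (k.+1 < 4 ^ m)%N -> junction_balance p m l g k).
Proof.
move=> p0 p1; have q0 : 0 < 1 - p by lra.
have c0 k : 2^-1 * weight p m k != 0.
  by rewrite gt_eqF // mulr_gt0 ?weight_gt0 // invr_gt0.
have succE k : ((4 * k + 0).+1 = (4 * k + 1)%N) * ((4 * k + 1).+1 = (4 * k + 2)%N)
  * ((4 * k + 2).+1 = (4 * k + 3)%N) * ((4 * k + 3).+1 = (4 * k.+1 + 0)%N).
  by do !split; lia.
have W := @weight_child p m.
split=> [b|[bc bj] j jN].
  split=> k kN.
    have := b (4 * k + 0)%N; have := b (4 * k + 1)%N; have := b (4 * k + 2)%N.
    rewrite !succE expnS !W //= !addn0.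
    move=> b2 b1 b0.
    split; apply: (mulfI (c0 k)).
    - by have := b0 ltac:(lia); lra.
    - apply: (mulfI (lt0r_neq0 q0)); have := b1 ltac:(lia); lra.
    - by have := b2 ltac:(lia); lra.
  have := b (4 * k + 3)%N; rewrite !succE expnS !W //= !addn0 => b3.
  apply: (mulfI (lt0r_neq0 p0)); have := b3 ltac:(lia); lra.
have : (j = 4 * (j %/ 4) + j %% 4)%N by rewrite mulnC -divn_eq.
have : (j %% 4 < 4)%N by rewrite ltn_mod.
move: (j %/ 4)%N (j %% 4)%N => k i i4 ej; rewrite expnS in jN.
have kN : (k < 4 ^ m)%N by lia.
have [b0 b1 b2] := bc k kN.
subst j; case: i i4 jN => [|[|[|[|//]]]] _ jN; rewrite !succE !W //= ?addn0.
- move/(congr1 (fun x => 2^-1 * weight p m k * x)): b0; lra.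
- move/(congr1 (fun x => 2^-1 * weight p m k * ((1 - p) * x))): b1; lra.
- move/(congr1 (fun x => 2^-1 * weight p m k * x)): b2; lra.
have kN' : (k.+1 < 4 ^ m)%N by lia.
have := bj k kN'; rewrite /junction_balance => /(congr1 (fun x => p / 2 * x)).
lra.
Qed.

(** * Exceptional values and branches as polynomial equations *)

Lemma exceptionalE p l : p < 1 ->
  (l \in exceptional p) = ((2 - l) * ((2 - l) ^+ 2 - 4 * (1 - p)) == 0).
Proof.
move=> p1; have q0 : 0 <= 1 - p by lra.
have -> : (2 - l) * ((2 - l) ^+ 2 - 4 * (1 - p)) =
  - ((l - 2) * ((l - 2 * (1 - Num.sqrt (1 - p))) *
     (l - 2 * (1 + Num.sqrt (1 - p))))).
  by rewrite -[in LHS](sqr_sqrtr q0); ring.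
by rewrite oppr_eq0 !mulf_eq0 !subr_eq0 !inE.
Qed.

Lemma mem_branches p l lm :
  ((2 - l) ^+ 2 - 2) ^+ 2 = 4 * (1 - p * lm + p ^+ 2 * lm) ->
  l \in branches p lm.
Proof.
rewrite /branches; move: (1 - _ + _) => r e.
have r0 : 0 <= r by rewrite -(pmulr_rge0 _ (ltr0n R 4)) -e sqr_ge0.
have sqrtE t : (2 - l) ^+ 2 = t -> l = 2 - Num.sqrt t \/ l = 2 + Num.sqrt t.
  move=> <-; rewrite sqrtr_sqr; case: ger0P => _; [left|right]; ring.
have : ((2 - l) ^+ 2 - (2 + 2 * Num.sqrt r)) *
       ((2 - l) ^+ 2 - (2 - 2 * Num.sqrt r)) = 0.
  transitivity (((2 - l) ^+ 2 - 2) ^+ 2 - 4 * Num.sqrt r ^+ 2); first by ring.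
  by rewrite e sqr_sqrtr // subrr.
rewrite !inE; move/eqP; rewrite mulf_eq0 !subr_eq0 => /orP[] /eqP /sqrtE [] <-;
  by rewrite eqxx ?orbT.
Qed.

(** [Num.sqrt] is 0 on negative numbers, so the squares can be undone only for nonnegative
    radicands; the bounds on [p * (1 - p) * lm] ensure this for both nested roots. *)
Lemma branches_eq p l lm : 0 <= p * (1 - p) * lm <= 1 -> l \in branches p lm ->
  ((2 - l) ^+ 2 - 2) ^+ 2 = 4 * (1 - p * lm + p ^+ 2 * lm).
Proof.
have -> : 1 - p * lm + p ^+ 2 * lm = 1 - p * (1 - p) * lm by ring.
rewrite /branches => /andP[lm0 lm1].
have -> : 1 - p * lm + p ^+ 2 * lm = 1 - p * (1 - p) * lm by ring.
have r0 : 0 <= 1 - p * (1 - p) * lm by lra.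
have s0 := sqrtr_ge0 (1 - p * (1 - p) * lm).
have s1 : Num.sqrt (1 - p * (1 - p) * lm) <= 1.
  by rewrite -[leRHS]sqrtr1; apply: ler_wsqrtr; lra.
rewrite -[in RHS](sqr_sqrtr r0); move: (Num.sqrt _) s0 s1 => s s0 s1.
have tp : 0 <= 2 + 2 * s by lra.
have tm : 0 <= 2 - 2 * s by lra.
have sqrN (x : R) : (2 - (2 - x)) ^+ 2 = x ^+ 2 by ring.
have sqrP (x : R) : (2 - (2 + x)) ^+ 2 = x ^+ 2 by ring.
by rewrite !inE => /or4P[] /eqP ->; rewrite ?sqrN ?sqrP sqr_sqrtr //; ring.
Qed.

(** * Spectral decimation away from the exceptional values *)

Definition cell_extension p l g k : Prop :=
  let q := 1 - p in
  let x1 := g (4 * k)%N in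
  let x2 := g (4 * k.+1)%N in
  [/\ g (4 * k + 1)%N =
        (- 4 * p * q * x2 - 2 * p * x1 * (2 + 2 * p - 4 * l + l ^+ 2))
          / ((- 4 * q + (l - 2) ^+ 2) * (l - 2)),
      g (4 * k + 2)%N = 2 * p * (x1 + x2) / ((l - 2) ^+ 2 - 4 * q) &
      g (4 * k + 3)%N =
        (- 4 * p * q * x1 - 2 * p * x2 * (2 + 2 * p - 4 * l + l ^+ 2))
          / ((- 4 * q + (l - 2) ^+ 2) * (l - 2))].

(** The cell equations form a 3 by 3 linear system in the inner values, with determinant s (s^2 - 4
    q) for s = 2 - l. *)
Lemma cell_balanceE p l g k : p < 1 -> l \notin exceptional p ->
  cell_balance p l g k <-> cell_extension p l g k.
Proof.
move=> p1; rewrite exceptionalE // mulf_eq0 negb_or => /andP[s0 d0].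
have s0' : l - 2 != 0 by rewrite -opprB oppr_eq0.
have d1 : (l - 2) ^+ 2 - 4 * (1 - p) != 0 by rewrite -(opprB l 2) sqrrN in d0.
have d2 : - 4 * (1 - p) + (l - 2) ^+ 2 != 0 by rewrite addrC mulNr.
rewrite /cell_balance /cell_extension /=.
move: (g _) (g _) (g _) (g _) (g _) => x2 y2 z x1 y1.
split=> [[e1 e2 e3]|[-> -> ->]].
  have ez : z = 2 * p * (x1 + x2) / ((l - 2) ^+ 2 - 4 * (1 - p)).
    apply: (mulIf d1); rewrite divfK //.
    move/(congr1 (fun x => (2 - l) * x)): e2; lra.
  split=> //; apply: (mulfI s0).
    by rewrite e1 ez; field; rewrite ?d1 ?d2 ?s0'.
  by rewrite e3 ez; field; rewrite ?d1 ?d2 ?s0'.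
by split; field; rewrite ?d1 ?d2 ?s0'.
Qed.

Lemma junction_balanceE p m l lm g k : 0 < p -> p < 1 ->
  l \notin exceptional p ->
  ((2 - l) ^+ 2 - 2) ^+ 2 = 4 * (1 - p * lm + p ^+ 2 * lm) ->
  cell_extension p l g k -> cell_extension p l g k.+1 ->
  junction_balance p m l g k <->
  (2 - lm) * (weight p m k + weight p m k.+1) * g (4 * k.+1)%N =
  2 * (weight p m k * g (4 * k)%N + weight p m k.+1 * g (4 * k.+2)%N).
Proof.
move=> p0 p1; rewrite exceptionalE // mulf_eq0 negb_or => /andP[s0 d0] e.
have s0' : l - 2 != 0 by rewrite -opprB oppr_eq0.
have d2 : - 4 * (1 - p) + (l - 2) ^+ 2 != 0.
  by rewrite -(opprB l 2) sqrrN in d0; rewrite addrC mulNr.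
rewrite /junction_balance => -[_ _ ->] [-> _ _].
move: (weight _ _ _) (weight _ _ _) (g _) (g _) (g _) => b a x2 x0 x1.
have c0 : 4 * p * (1 - p) != 0.
  by rewrite gt_eqF // mulr_gt0 ?mulr_gt0 // subr_gt0.
set D := _ * (l - 2); have D0 : D != 0 by rewrite mulf_neq0.
set y1 := _ / D; set y2 := _ / D.
(* Once D is cleared, the coefficient of (a + b) x1 is s^4 - 4 s^2 + 8 p q = (s^2 - 2)^2 - 4 + 8 p
   q, which [e] turns into 4 p q (2 - lm). *)
have E : - D * ((2 - l) * (a + b) * x1 - 2 * (a * y1 + b * y2)) =
    4 * p * (1 - p) * ((2 - lm) * (a + b) * x1 - 2 * (a * x0 + b * x2)).
  transitivity (- D * ((2 - l) * (a + b) * x1) + 2 * (a * (y1 * D) + b * (y2 * D))).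
    by ring.
  rewrite !divfK // /D; move/(congr1 (fun t => (a + b) * x1 * t)): e; lra.
split=> /eqP; rewrite -subr_eq0 => /eqP h; apply/eqP; rewrite -subr_eq0.
  by apply/eqP/(mulfI c0); rewrite -E h !mulr0.
by apply/eqP/(@mulfI _ (- D)); rewrite ?oppr_eq0 // E h !mulr0.
Qed.

Lemma eigenseq_decimation p m l lm g : 0 < p -> p < 1 ->
  l \notin exceptional p ->
  ((2 - l) ^+ 2 - 2) ^+ 2 = 4 * (1 - p * lm + p ^+ 2 * lm) ->
  (forall k, (k < 4 ^ m)%N -> cell_extension p l g k) ->
  eigenseq p m.+1 l g <-> eigenseq p m lm (fun k => g (4 * k)%N).
Proof.
move=> p0 p1 lE e ext; rewrite /eigenseq muln0 -expnS.
split=> -[[k kN gk] g0 g1 b]; split=> //.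
(* The restriction to V_m must be nonzero: the extension formulas vanish on a cell whose two
   endpoint values vanish. *)
- have gj j : (j <= 4 ^ m)%N -> g (4 * j)%N != 0 ->
      exists2 i, (i <= 4 ^ m)%N & g (4 * i)%N != 0 by exists j.
  move: kN gk; rewrite (divn_eq k 4) mulnC expnS.
  have : (k %% 4 < 4)%N by rewrite ltn_mod.
  move: (k %/ 4)%N (k %% 4)%N => {}k i i4 kN gk.
  (* The right end of the interval starts no cell and is treated apart. *)
  have [k4|k4] := leqP (4 ^ m) k.
    have i0 : i = 0%N by lia.
    by apply: (gj k); [lia | rewrite i0 addn0 in gk].
  have [x1|] := eqVneq (g (4 * k)%N) 0; last by apply: gj; lia.
  have [x2|] := eqVneq (g (4 * k.+1)%N) 0; last exact: gj.
  have [y1 z y2] := ext k k4.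
  case: i i4 gk {kN} => [|[|[|[|//]]]] _; rewrite ?addn0 ?y1 ?z ?y2 x1 ?x2;
    by rewrite ?(addr0, mulr0, mul0r, subr0, oppr0) eqxx.
- move/(balance_child m l g p0 p1): b => [_ bj] j jN /=.
  by apply/(junction_balanceE m p0 p1 lE e (ext j (ltnW jN)) (ext _ jN))/bj.
- by exists (4 * k)%N => //; rewrite expnS leq_mul2l.
- apply/(balance_child m l g p0 p1); split=> j jN.
    exact/cell_balanceE/ext.
  exact/(junction_balanceE m p0 p1 lE e (ext j (ltnW jN)) (ext _ jN))/b.
Qed.

(** * Eigenvalues born on level m+1 *)

(* An eigenvector vanishing on V_m: its values on the k-th cell are
   (- c3) ^ k / weight k times (0, 1, c2, c3, 0); the weights and the sign
   balance the two sides of each junction. *)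
Lemma eigenseq_cellwise p m l c2 c3 : 0 < p -> p < 1 ->
  2 - l = 2 * ((1 - p) * c2) -> (2 - l) * c2 = 1 + c3 ->
  (2 - l) * c3 = 2 * ((1 - p) * c2) ->
  exists g, eigenseq p m.+1 l g.
Proof.
move=> p0 p1 e1 e2 e3.
pose g k := (- c3) ^+ (k %/ 4) / weight p m (k %/ 4)
            * nth 0 [:: 0; 1; c2; c3] (k %% 4).
have gE k i : (i < 4)%N ->
    g (4 * k + i)%N = (- c3) ^+ k / weight p m k * nth 0 [:: 0; 1; c2; c3] i.
  by move=> i4; rewrite /g mulnC modnMDl divnMDl // divn_small // modn_small ?addn0.
have g4 k : g (4 * k)%N = 0 by rewrite -[(4 * k)%N]addn0 gE // mulr0.
have w0 k : weight p m k != 0 by rewrite gt_eqF // weight_gt0.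
exists g; split.
- exists 1%N; first by rewrite expn_gt0.
  by rewrite -[1%N]/(4 * 0 + 1)%N gE //= expr0 mulr1 mul1r invr_eq0.
- exact: g4 0%N.
- by rewrite expnS g4.
apply/(balance_child m l g p0 p1); split=> k kN; last first.
  rewrite /junction_balance g4 mulr0 !gE //= exprSr.
  by field; rewrite !w0.
rewrite /cell_balance !g4 !gE //= mulr0 add0r.
split; move: ((- c3) ^+ k / _) => t.
- by rewrite mulr1 e1; ring.
- by rewrite mulrCA e2; ring.
- by rewrite mulrCA e3; ring.
Qed.

Lemma exceptional_eigenvalue p m l : 0 < p -> p < 1 -> l \in exceptional p ->
  dirichlet_eigenvalue p m.+1 l.
Proof.
move=> p0 p1; rewrite exceptionalE // mulf_eq0 => lE.
have q0 : 1 - p != 0 by rewrite gt_eqF // subr_gt0.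
apply/dirichlet_eigenvalueE => //; case/orP: lE => /eqP e.
  (* For s = 0 the profile is antisymmetric: (0, 1, 0, -1, 0). *)
  by apply: (@eigenseq_cellwise _ m l 0 (- 1)) => //; rewrite e; ring.
(* For s^2 = 4 q it is symmetric; the equation at the first inner point fixes the middle value s /
   (2 q). *)
apply: (@eigenseq_cellwise _ m l ((2 - l) / (2 * (1 - p))) 1) => //.
- by field.
- have -> : (2 - l) * ((2 - l) / (2 * (1 - p))) = (2 - l) ^+ 2 / (2 * (1 - p)).
    by rewrite mulrA.
  by rewrite (subr0_eq e); field.
- by field.
Qed.

(** The zero at the left end propagates from cell to cell: when the left endpoint value is 0, the
    cell equations force the right one to be 0. *)
Lemma exceptional_vanish p m l g k : 0 < p -> p < 1 -> l \in exceptional p ->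
  eigenseq p m.+1 l g -> (k <= 4 ^ m)%N -> g (4 * k)%N = 0.
Proof.
move=> p0 p1; rewrite exceptionalE // mulf_eq0 => lE.
case=> _ g0 _ /(balance_child m l g p0 p1) [bc _].
elim: k => [|k IH] kN; first by rewrite muln0.
have [e1 e2 e3] := bc k kN; move: e1 e2 e3; rewrite IH 1?ltnW // mulr0 add0r.
move: (g _) (g _) (g _) (g _) => x y2 z y1 e1 e2 e3.
apply: (mulfI (lt0r_neq0 p0)); case/orP: lE => /eqP e.
  by move: e1 e2 e3; rewrite e; lra.
(* Multiplying by s and substituting the outer equations gives s^2 z = 4 q z + 2 p x, hence p x =
   0. *)
move: e2 => /(congr1 (fun t => (2 - l) * t)).
move: e => /(congr1 (fun t => z * t)); lra.
Qed.

(** * Branches over actual eigenvalues, and the complete spectrum *)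

Lemma eigenvalue_branch p m l lm : 0 < p -> p < 1 ->
  dirichlet_eigenvalue p m lm -> l \in branches p lm ->
  ((2 - l) ^+ 2 - 2) ^+ 2 = 4 * (1 - p * lm + p ^+ 2 * lm).
Proof.
move=> p0 p1 /(dirichlet_eigenvalueE m lm p0 p1) [h].
move=> /(eigenvalue_bounds p0 p1) /andP[lm0 lm4]; apply: branches_eq.
have pq0 : 0 <= p * (1 - p) by rewrite mulr_ge0 ?subr_ge0 // ltW.
(* With lm <= 4 this yields p q lm <= 1. *)
have pq1 : 4 * (p * (1 - p)) <= 1 by have := sqr_ge0 (1 - 2 * p); lra.
rewrite mulr_ge0 //= (le_trans (ler_wpM2l pq0 lm4)) //; lra.
Qed.

Lemma decimation_extension_exists p m l u :
  exists v, decimation_extension p m l u v.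
Proof.
pose values x1 x2 := [:: x1;
  (- 4 * p * (1 - p) * x2 - 2 * p * x1 * (2 + 2 * p - 4 * l + l ^+ 2))
    / ((- 4 * (1 - p) + (l - 2) ^+ 2) * (l - 2));
  2 * p * (x1 + x2) / ((l - 2) ^+ 2 - 4 * (1 - p));
  (- 4 * p * (1 - p) * x1 - 2 * p * x2 * (2 + 2 * p - 4 * l + l ^+ 2))
    / ((- 4 * (1 - p) + (l - 2) ^+ 2) * (l - 2))].
have [v vE] := interpolation m.+1 (fun k =>
  (values (u (pt R m (k %/ 4))) (u (pt R m (k %/ 4).+1)))`_(k %% 4)).
have v4 k i : (i < 4)%N -> v (pt R m.+1 (4 * k + i)) =
    (values (u (pt R m k)) (u (pt R m k.+1)))`_i.
  move=> i4.
  by rewrite vE mulnC modnMDl divnMDl // divn_small // modn_small ?addn0.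
exists v; split=> [k _|k _]; last by rewrite /= !v4.
by rewrite -[in LHS]pt_child -[(4 * k)%N]addn0 v4.
Qed.

End Path.

Theorem theorem3p5 (R : realType) (p : R) (m : nat)
    (p_gt0 : 0 < p) (p_lt1 : p < 1) (m_ge1 : (1 <= m)%N) :
  (forall (lm l : R) (u v : R -> R),
     dirichlet_eigenfunction p m lm u ->
     l \in branches p lm ->
     l \notin exceptional p ->
     decimation_extension p m l u v ->
     dirichlet_eigenfunction p m.+1 l v)
  /\
  ((forall l : R, l \in exceptional p -> born p m l) /\
   (forall l : R,
      dirichlet_eigenvalue p m.+1 l <->
      (exists lm : R, [/\ dirichlet_eigenvalue p m lm,
                          l \in branches p lm & l \notin exceptional p])
      \/ l \in exceptional p)).
Proof.
have extension_eigen lm l u v : dirichlet_eigenfunction p m lm u ->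
    l \in branches p lm -> l \notin exceptional p ->
    decimation_extension p m l u v -> dirichlet_eigenfunction p m.+1 l v.
  move=> hu lb lE [uv ext]; apply/dirichlet_eigenfunctionE => //.
  have e : ((2 - l) ^+ 2 - 2) ^+ 2 = 4 * (1 - p * lm + p ^+ 2 * lm).
    exact: eigenvalue_branch p_gt0 p_lt1 (ex_intro _ u hu) lb.
  apply/(eigenseq_decimation p_gt0 p_lt1 lE e).
    move=> k kN; rewrite /cell_extension !pt_child !uv ?(ltnW kN) //.
    exact: ext.
  move/(dirichlet_eigenfunctionE m lm u p_gt0 p_lt1): hu; apply: eigenseq_ext.
  by move=> k kN; rewrite pt_child uv.
split=> //; split=> [l lE|l].
  split; first exact: exceptional_eigenvalue.
  case=> lm [u [v []]].
  move=> [[k kN uk] _ _ _] /(dirichlet_eigenfunctionE m.+1 l v p_gt0 p_lt1) hv uv.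
  (* The extended function is nonzero somewhere on V_m, where eigenfunctions for exceptional values
     vanish. *)
  move: uk; rewrite -uv // -pt_child.
  by rewrite (exceptional_vanish p_gt0 p_lt1 lE hv kN) eqxx.
split=> [|[[lm [[u hu] lb lE]]|]].
- move=> /(dirichlet_eigenvalueE m.+1 l p_gt0 p_lt1) [g hg].
  case: (boolP (l \in exceptional p)) => lE; [by right | left].
  have pq0 : p * (1 - p) != 0 by rewrite mulf_neq0 ?gt_eqF // subr_gt0.
  (* The branch equation is linear in lm; this is its solution. *)
  pose lm := (1 - ((2 - l) ^+ 2 - 2) ^+ 2 / 4) / (p * (1 - p)).
  have e : ((2 - l) ^+ 2 - 2) ^+ 2 = 4 * (1 - p * lm + p ^+ 2 * lm).
    have -> : 1 - p * lm + p ^+ 2 * lm = 1 - lm * (p * (1 - p)) by ring.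
    by rewrite /lm divfK //; field.
  exists lm; split=> //; last exact: mem_branches.
  apply/dirichlet_eigenvalueE => //; exists (fun k => g (4 * k)%N).
  apply/(eigenseq_decimation p_gt0 p_lt1 lE e) => //.
  case: hg => _ _ _ /(balance_child m l g p_gt0 p_lt1) [bc _] k kN.
  exact/(cell_balanceE g k p_lt1 lE)/bc.
- have [v hv] := decimation_extension_exists p m l u.
  by exists v; exact: extension_eigen hu lb lE hv.
- exact: exceptional_eigenvalue.
Qed.
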